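(* Let $d\ge1$, $n\ge1$, let $\mathbf x_1,\dots,\mathbf x_n\in\mathbb R^d$, $\mathbb P_n=\frac1n\sum_{i=1}^n\delta_{\{\mathbf x_i\}}$, let $H$ be the convex hull of $\mathbf x_1,\dots,\mathbf x_n$ and $d(\mathbf z,H)=\inf\{\|\mathbf z-\mathbf y\|:\mathbf y\in H\}$. The following is true for any $\delta>0$ and $\mathbf z\in\mathbb R^d$: (1) If $d(\mathbf z,H)\ge\delta n$ then $D_\delta(\mathbf z|\mathbb P_n)=\delta/d(\mathbf z,H)\le1/n$. (2) For $\alpha\in(0,1/n]$ the level set is given by $\{\mathbf z:D_\delta(\mathbf z|\mathbb P_n)=\alpha\}=\{\mathbf z:d(\mathbf z,H)=\delta/\alpha\}$. (3) $D_\delta(\mathbf z|\mathbb P_n)\sim\delta/\|\mathbf z\|$ as $\|\mathbf z\|\to\infty$, i.e. $\|\mathbf z\|D_\delta(\mathbf z|\mathbb P_n)\to\delta$.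
   Context: $\delta_{\{\mathbf x\}}$ is the Dirac mass at $\mathbf x$ (not to be confused with the number $\delta>0$), $\|\cdot\|$ the Euclidean norm, $\langle\cdot,\cdot\rangle$ the Euclidean inner product. For laws $\mathbb P,\mathbb P'$ on $\mathbb R^d$ the Wasserstein distance is $d_W(\mathbb P,\mathbb P')=\inf_\Pi\int\|\mathbf x-\mathbf y\|\,\Pi(\mathrm d\mathbf x,\mathrm d\mathbf y)\in[0,\infty]$, over all joint laws $\Pi$ on $\mathbb R^d\times\mathbb R^d$ with marginals $\mathbb P,\mathbb P'$. The robustified halfspace depth is $$D_\delta(\mathbf z|\mathbb P)=\inf_{\mathbf u\in\mathbb R^d:\|\mathbf u\|=1}\ \sup_{\mathbb P':d_W(\mathbb P',\mathbb P)\le\delta}\mathbb P'(\{\mathbf x\in\mathbb R^d:\langle\mathbf u,\mathbf x-\mathbf z\rangle\ge0\}).$$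
   Formalization: Part (2) is stated for α in (0,1/n] with α<1, which excludes only n=1, α=1; there the claim fails: for n=1 and z=x_1 the depth is 1=α, yet d(z,H)=0 differs from δ/α=δ. *)

(* Defs.v *)
From HB Require Import structures.
From mathcomp Require Import all_boot all_order all_algebra.
From mathcomp Require Import all_classical all_reals all_analysis.
Set Implicit Arguments.
Unset Strict Implicit.
Unset Printing Implicit Defensive.
Import Order.TTheory GRing.Theory Num.Theory.
Import numFieldNormedType.Exports.
Local Open Scope classical_set_scope.
Local Open Scope ring_scope.

(* The norm `|x| of MathComp-Analysis on 'rV[R]_d is the sup norm, hence the
   separate Euclidean norm; both induce the same topology. *)
Definition inner {R : realType} {d : nat} (u v : 'rV[R]_d) : R :=
  \sum_(i < d) u ord0 i * v ord0 i.

Definition enorm {R : realType} {d : nat} (u : 'rV[R]_d) : R :=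
  Num.sqrt (inner u u).

Definition borel_rV (R : realType) (d : nat) :=
  g_sigma_algebraType (@open 'rV[R]_d).

Notation law R d := (probability (borel_rV R d) R).

Section empirical.
Context {R : realType} {d n : nat}.
Local Open Scope ereal_scope.

(* The unused proof of 0 < n makes the set function a probability. *)
Definition empirical (n_gt0 : (0 < n)%N) (x : 'I_n -> 'rV[R]_d) :
    set (borel_rV R d) -> \bar R :=
  fun A => (n%:R^-1)%:E * \sum_(i < n) \d_(x i : borel_rV R d) A.

Variables (n_gt0 : (0 < n)%N) (x : 'I_n -> 'rV[R]_d).

Let empirical0 : empirical n_gt0 x set0 = 0.
Proof. by rewrite /empirical big1 ?mule0// => i _; rewrite measure0. Qed.

Let empirical_ge0 A : 0 <= empirical n_gt0 x A.
Proof. by rewrite mule_ge0 ?lee_fin ?invr_ge0// sume_ge0. Qed.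

Let empirical_sigma_additive : semi_sigma_additive (empirical n_gt0 x).
Proof.
move=> F mF tF mUF; rewrite [X in _ --> X](_ : _ =
    lim ((fun m => \sum_(0 <= i < m) empirical n_gt0 x (F i))%E @ \oo)).
  by apply: is_cvg_ereal_nneg_natsum => k _; exact: empirical_ge0.
rewrite /empirical nneseriesZl//; last by move=> i _; exact: sume_ge0.
rewrite nneseries_sum//; congr (_ * _); apply: eq_bigr => /= i _.
exact: measure_semi_bigcup.
Qed.

HB.instance Definition _ := isMeasure.Build _ _ _ (empirical n_gt0 x)
  empirical0 empirical_ge0 empirical_sigma_additive.

Let empirical_setT : empirical n_gt0 x [set: _] = 1.
Proof.
rewrite /empirical (eq_bigr (fun=> 1)) => [|i _]; last by rewrite diracT.
rewrite sumEFin big_const_ord iter_addr_0 -EFinM mulVf//.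
by rewrite pnatr_eq0 -lt0n.
Qed.

HB.instance Definition _ :=
  Measure_isProbability.Build _ _ _ (empirical n_gt0 x) empirical_setT.

End empirical.

(* Marginals are compared on measurable sets only: the value of a measure
   elsewhere carries no information. *)
Definition coupling {R : realType} {d : nat} (P P' : law R d) :
    set (probability (borel_rV R d * borel_rV R d)%type R) :=
  [set Pi | forall A : set (borel_rV R d), measurable A ->
     Pi (fst @^-1` A) = P A /\ Pi (snd @^-1` A) = P' A].

Definition wasserstein {R : realType} {d : nat} (P P' : law R d) : \bar R :=
  ereal_inf [set (\int[Pi]_xy (enorm (xy.1 - xy.2 : 'rV[R]_d))%:E)%E
            | Pi in coupling P P'].

Definition halfspace {R : realType} {d : nat} (u z : 'rV[R]_d) :
    set (borel_rV R d) :=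
  [set x : 'rV[R]_d | 0 <= inner u (x - z)].

Definition robust_depth {R : realType} {d : nat} (delta : R)
    (z : 'rV[R]_d) (P : law R d) : \bar R :=
  ereal_inf [set ereal_sup [set P' (halfspace u z)
                           | P' in [set P' : law R d |
                                    (wasserstein P' P <= delta%:E)%E]]
            | u in [set u : 'rV[R]_d | enorm u = 1]].

Definition convex_hull {R : realType} {d n : nat} (x : 'I_n -> 'rV[R]_d) :
    set 'rV[R]_d :=
  [set y | exists w : 'I_n -> R,
     [/\ forall i, 0 <= w i, \sum_(i < n) w i = 1
       & y = \sum_(i < n) w i *: x i]].

Definition dist_set {R : realType} {d : nat} (z : 'rV[R]_d)
    (H : set 'rV[R]_d) : R :=
  inf [set enorm (z - y) | y in H].

Definition enorm_infty {R : realType} {d : nat} : set_system 'rV[R]_d :=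
  filter_from [set: R] (fun M => [set z | M < enorm z]).

(* Main.v *)
Require Import Defs.
From HB Require Import structures.
From mathcomp Require Import all_boot all_order all_algebra.
From mathcomp Require Import all_classical all_reals all_analysis.
From mathcomp Require Import measurable_realfun ring lra.
Import Order.TTheory GRing.Theory Num.Theory.
Import numFieldNormedType.Exports.
Local Open Scope classical_set_scope.
Local Open Scope ring_scope.

(** Fix a unit vector [u] and put [r_i = max(0, <u, z - x_i>)], the distance of
    [x_i] to the halfspace [h = {x | <u, x - z> >= 0}]. Moving mass [p_i <= 1/n]
    from [x_i] to [x_i + r_i u] produces a law giving [h] mass at least
    [sum p_i], at cost [sum p_i r_i].

    Let [y] be the point of [H] nearest to [z] and [D = |z - y|]. For every [u]
    the average of the [<u, z - x_i>] with the weights of [y] is at most [D], so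
    some [r_i <= D], and mass [min(1/n, delta / D)] can be moved into [h]. When
    [D < delta n], a full atom is moved and a budget bounded below uniformly in
    [u] remains for the other atoms, so the depth exceeds [1/n] (or equals [1]
    if [n = 1]). Conversely, for [u = (z - y) / D] every [x_i] has
    [r_i >= D], so any coupling costs at least [D] per unit of mass in [h] and
    the depth is at most [delta / D]. Finally [| D - |z| |] is bounded. *)

(** * Euclidean inner product and norm on row vectors *)

Section euclidean.
Context {R : realType} {d : nat}.
Implicit Types (u v w : 'rV[R]_d) (c : R).

Lemma innerC u v : inner u v = inner v u.
Proof. by apply: eq_bigr => i _; rewrite mulrC. Qed.

Lemma innerDr u v w : inner u (v + w) = inner u v + inner u w.
Proof. by rewrite -big_split; apply: eq_bigr => i _; rewrite mxE mulrDr. Qed.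

Lemma innerZr c u v : inner u (c *: v) = c * inner u v.
Proof. by rewrite mulr_sumr; apply: eq_bigr => i _; rewrite mxE mulrCA. Qed.

Lemma innerNr u v : inner u (- v) = - inner u v.
Proof. by rewrite -scaleN1r innerZr mulN1r. Qed.

Lemma innerBr u v w : inner u (v - w) = inner u v - inner u w.
Proof. by rewrite innerDr innerNr. Qed.

Lemma innerDl u v w : inner (u + v) w = inner u w + inner v w.
Proof. by rewrite !(innerC _ w) innerDr. Qed.

Lemma innerZl c u v : inner (c *: u) v = c * inner u v.
Proof. by rewrite !(innerC _ v) innerZr. Qed.

Lemma innerBl u v w : inner (u - v) w = inner u w - inner v w.
Proof. by rewrite !(innerC _ w) innerBr. Qed.

Lemma innerNl u v : inner (- u) v = - inner u v.
Proof. by rewrite !(innerC _ v) innerNr. Qed.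

Lemma innerB_sqr c u v : inner (u - c *: v) (u - c *: v) =
  inner u u - 2 * c * inner u v + c ^+ 2 * inner v v.
Proof. by rewrite innerBl !innerBr !innerZl !innerZr (innerC v u); ring. Qed.

Lemma inner0r u : inner u 0 = 0.
Proof. by rewrite -(scale0r 0) innerZr mul0r. Qed.

Lemma inner_sumr n u (f : 'I_n -> 'rV[R]_d) :
  inner u (\sum_(i < n) f i) = \sum_(i < n) inner u (f i).
Proof. exact: (big_morph _ (innerDr u) (inner0r u)). Qed.

Lemma inner_ge0 u : 0 <= inner u u.
Proof. by apply: sumr_ge0 => i _; rewrite -expr2 sqr_ge0. Qed.

Lemma inner_eq0 u : inner u u = 0 -> u = 0.
Proof.
move=> /psumr_eq0P u0; apply/rowP => i; rewrite mxE; apply/eqP.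
by rewrite -sqrf_eq0 expr2 u0// => j _; rewrite -expr2 sqr_ge0.
Qed.

Lemma enorm_ge0 u : 0 <= enorm u. Proof. exact: sqrtr_ge0. Qed.

Lemma sqr_enorm u : enorm u ^+ 2 = inner u u.
Proof. by rewrite sqr_sqrtr// inner_ge0. Qed.

Lemma enorm0 : enorm (0 : 'rV[R]_d) = 0.
Proof. by rewrite /enorm inner0r sqrtr0. Qed.

Lemma enorm_eq0 u : enorm u = 0 -> u = 0.
Proof. by move=> u0; apply: inner_eq0; rewrite -sqr_enorm u0 expr0n. Qed.

Lemma enormZ c u : enorm (c *: u) = `|c| * enorm u.
Proof.
by rewrite /enorm innerZl innerZr mulrA -expr2 sqrtrM ?sqr_ge0// sqrtr_sqr.
Qed.

Lemma enormN u : enorm (- u) = enorm u.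
Proof. by rewrite -scaleN1r enormZ normrN1 mul1r. Qed.

Lemma cauchy_schwarz u v : inner u v <= enorm u * enorm v.
Proof.
have [u0|u0] := eqVneq (enorm u) 0.
  by rewrite (enorm_eq0 u u0) innerC inner0r enorm0 mul0r.
have [v0|v0] := eqVneq (enorm v) 0.
  by rewrite (enorm_eq0 v v0) inner0r enorm0 mulr0.
have uv0 : 0 < enorm u * enorm v.
  by rewrite mulr_gt0// lt_neqAle enorm_ge0 eq_sym ?u0 ?v0.
(* This square expands to twice [|u||v| (|u||v| - <u,v>)]; the factor [|u||v|] is then cancelled,
   which is why the zero vectors were split off. *)
have := inner_ge0 (enorm v *: u - enorm u *: v).
rewrite innerBl !innerBr !innerZl !innerZr (innerC v u) -!sqr_enorm => h.
by rewrite -(ler_pM2l uv0); nra.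
Qed.

Lemma ler_enormD u v : enorm (u + v) <= enorm u + enorm v.
Proof.
rewrite -(@ler_pXn2r _ 2)// ?nnegrE ?addr_ge0 ?enorm_ge0//.
rewrite sqr_enorm innerDl !innerDr (innerC v u) -!sqr_enorm.
by have := cauchy_schwarz u v; nra.
Qed.

Lemma enorm_sum n (f : 'I_n -> 'rV[R]_d) :
  enorm (\sum_(i < n) f i) <= \sum_(i < n) enorm (f i).
Proof.
elim/big_ind2: _ => [|a1 b1 a2 b2 h1 h2|//]; first by rewrite enorm0.
by rewrite (le_trans (ler_enormD _ _))// lerD.
Qed.

End euclidean.

Lemma continuous_sum (R : realType) (T : topologicalType) n (f : 'I_n -> T -> R) :
  (forall i, continuous (f i)) -> continuous (fun t => \sum_(i < n) f i t).
Proof.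
move=> cf; apply: continuous_big => //; exact: add_continuous.
Qed.

(** * Nearest points in the convex hull of finitely many points *)

Section convex_hull_projection.
Context {R : realType} {d n : nat}.
Variable x : 'I_n -> 'rV[R]_d.
Implicit Types (y z : 'rV[R]_d).

Lemma convex_hull_vertex i : convex_hull x (x i).
Proof.
exists (fun j => (j == i)%:R); split => [j||].
- by rewrite ler0n.
- by rewrite (bigD1 i)//= eqxx big1 ?addr0// => j /negbTE ->.
- rewrite (bigD1 i)//= eqxx scale1r big1 ?addr0// => j /negbTE ->.
  by rewrite scale0r.
Qed.

Lemma convex_hull_segment y y' (t : R) : 0 <= t <= 1 ->
  convex_hull x y -> convex_hull x y' -> convex_hull x (y + t *: (y' - y)).
Proof.
move=> /andP[t0 t1] [w [w0 w1 ->]] [w' [w'0 w'1 ->]].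
exists (fun i => (1 - t) * w i + t * w' i); split => [i||].
- by rewrite addr_ge0// mulr_ge0// subr_ge0.
- by rewrite big_split/= -!mulr_sumr w1 w'1 !mulr1 subrK.
- rewrite -sumrB scaler_sumr -big_split/=; apply: eq_bigr => i _.
  by rewrite scalerBr !scalerA scalerDl mulrBl mul1r scalerBl addrA addrAC.
Qed.

(** Heine-Borel: each weight is at most the total 1, and the constraints are closed conditions on
    continuous functions. Weights are row vectors here so that they carry a topology. *)
Lemma compact_simplex :
  compact [set w : 'rV[R]_n | (forall i, 0 <= w ord0 i) /\
                              \sum_(i < n) w ord0 i = 1].
Proof.
apply: bounded_closed_compact.
  exists 1; split => // M M1 w [w0 w1].
  apply: le_trans (ltW M1); rewrite [leLHS]/Num.norm /= mx_normrE.
  apply/bigmax_leP; split => // -[i j] _ /=; rewrite (ord1 i) ger0_norm//.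
  by rewrite -w1 (bigD1 j)//= lerDl sumr_ge0.
rewrite (_ : mkset _ =
    (\bigcap_(i in [set: 'I_n])
       ((fun w : 'rV[R]_n => w ord0 i) @^-1` [set t | 0 <= t])) `&`
    ((fun w : 'rV[R]_n => \sum_(i < n) w ord0 i) @^-1` [set t | t = 1]));
    last first.
  apply/seteqP; split => [w [w0 w1]|w [w0 w1]].
    by split => // i _; exact: w0.
  by split => // i; exact: (w0 i).
apply: closedI.
  apply: closed_bigI => i _; apply: preimage_closed; last exact: closed_ge.
  by move=> w _; exact: coord_continuous.
apply: preimage_closed; last exact: closed_eq.
by move=> w _; apply: continuous_sum => i; exact: coord_continuous.
Qed.

Lemma continuous_sqdist_comb z : continuous (fun w : 'rV[R]_n =>
  inner (z - \sum_(i < n) w ord0 i *: x i) (z - \sum_(i < n) w ord0 i *: x i)).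
Proof.
apply: continuous_sum => k.
have ck : continuous (fun w : 'rV[R]_n =>
    (z - \sum_(i < n) w ord0 i *: x i) ord0 k).
  rewrite (_ : (fun _ => _) = (fun w : 'rV[R]_n =>
      z ord0 k - \sum_(i < n) w ord0 i * x i ord0 k)); last first.
    apply/funext => w; rewrite !mxE summxE; congr (_ - _).
    by apply: eq_bigr => i _; rewrite mxE.
  move=> w; apply: continuousB; first exact: cst_continuous.
  apply: continuous_sum => i v.
  by apply: continuousM; [exact: coord_continuous|exact: cst_continuous].
by move=> w; apply: continuousM; exact: ck.
Qed.

(** The minimum is sought over the compact simplex of weights rather than over the hull, for the
    squared distance, which is polynomial in the weights; monotonicity of the square root transfers
    the result. *)
Lemma dist_set_attained z : (0 < n)%N ->
  exists2 y, convex_hull x y & dist_set z (convex_hull x) = enorm (z - y).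
Proof.
move=> n0.
have [|w /[!inE] -[w0 w1] wmin] := EVT_min_rV _ compact_simplex
    (continuous_subspaceT (continuous_sqdist_comb z)).
  exists (\row_i (i == Ordinal n0)%:R); split => [i|].
    by rewrite mxE ler0n.
  rewrite (bigD1 (Ordinal n0))//= mxE eqxx big1 ?addr0// => j /negbTE jn.
  by rewrite mxE jn.
have Hy : convex_hull x (\sum_(i < n) w ord0 i *: x i).
  by exists (w ord0).
exists (\sum_(i < n) w ord0 i *: x i) => //; apply/le_anti/andP; split.
  apply: ge_inf; last by exists (\sum_(i < n) w ord0 i *: x i).
  by exists 0 => _ [y _ <-]; exact: enorm_ge0.
apply: lb_le_inf; first by eexists; exists (\sum_(i < n) w ord0 i *: x i).
move=> _ [_ [v [v0 v1 ->]] <-].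
have vE : \sum_(i < n) (\row_i v i) ord0 i *: x i = \sum_(i < n) v i *: x i.
  by apply: eq_bigr => i _; rewrite mxE.
rewrite -vE; apply/ler_wsqrtr/wmin; rewrite inE; split => [i|].
  by rewrite mxE.
by rewrite -[RHS]v1; apply: eq_bigr => i _; rewrite mxE.
Qed.

Lemma dist_set_le z y : convex_hull x y ->
  dist_set z (convex_hull x) <= enorm (z - y).
Proof.
move=> Hy; apply: ge_inf; last by exists y.
by exists 0 => _ [? _ <-]; exact: enorm_ge0.
Qed.

(** First-order optimality: were the inner product positive, a small step from [y] towards [x i]
    would stay in the hull and come closer to [z]. *)
Lemma projection_obtuse z y : convex_hull x y ->
  dist_set z (convex_hull x) = enorm (z - y) ->
  forall i, inner (z - y) (x i - y) <= 0.
Proof.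
move=> Hy dzy i; rewrite leNgt; apply/negP => a0.
set v := z - y in dzy a0 *; set b := x i - y in a0 *.
have key t : 0 <= t <= 1 -> 2 * t * inner v b <= t ^+ 2 * inner b b.
  move=> t01; have Ht := convex_hull_segment _ _ _ t01 Hy (convex_hull_vertex i).
  have := dist_set_le z _ Ht; rewrite dzy opprD addrA -/v -/b.
  move/(lerXn2r 2 (enorm_ge0 _) (enorm_ge0 _)); rewrite !sqr_enorm.
  by rewrite innerB_sqr; lra.
have b0 := inner_ge0 b.
have s0 : 0 < inner v b + inner b b by rewrite ltr_wpDr.
(* With [a = <v,b>] and [B = <b,b>], [key] gives [2 a <= t B] for [0 < t <= 1]. The choice
   [t = a / (a + B)] is admissible even if [B = 0], and gives [t B = a - t a < a], a
   contradiction. *)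
have [t [ts t0 t1]] : exists t : R,
    [/\ t * (inner v b + inner b b) = inner v b, 0 < t & t <= 1].
  exists (inner v b / (inner v b + inner b b)); split.
  - by rewrite divfK// gt_eqF.
  - by rewrite divr_gt0.
  - by rewrite ler_pdivrMr// mul1r lerDl.
have ta0 : 0 < t * inner v b by rewrite mulr_gt0.
have := key t; rewrite (ltW t0) t1 => /(_ isT).
rewrite expr2 (mulrC 2) -!mulrA ler_pM2l//.
by move: ts; rewrite mulrDr; lra.
Qed.

End convex_hull_projection.

(** * Measurability of halfspaces and of the transport cost *)

Section borel.
Context {R : realType} {d : nat}.

Lemma measurable_coord (i : 'I_d) :
  measurable_fun [set: borel_rV R d] (fun v : 'rV[R]_d => v ord0 i).
Proof.
apply: (measurability _ (RGenOpens.measurableE R)).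
move=> _ [_ [a [b ->] <-]]; rewrite setTI; apply: sub_sigma_algebra.
have /continuousP := @coord_continuous R 1 d ord0 i.
by apply; exact: interval_open.
Qed.

Lemma measurable_inner (u z : 'rV[R]_d) :
  measurable_fun [set: borel_rV R d] (fun v : 'rV[R]_d => inner u (v - z)).
Proof.
apply: measurable_sum => i; apply: measurable_funM => //.
under eq_fun do rewrite !mxE.
by apply: measurable_funB => //; exact: measurable_coord.
Qed.

Lemma measurable_halfspace (u z : 'rV[R]_d) : measurable (halfspace u z).
Proof.
have := measurable_inner u z measurableT _ (measurable_itv `[0, +oo[).
rewrite setTI; congr measurable; apply/seteqP; split=> v /=;
  by rewrite in_itv/= andbT.
Qed.

(** The sigma-algebra on pairs is the product of the two Borel ones, so the argument goes through
    coordinates and projections rather than through continuity on pairs. *)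
Lemma measurable_edist : measurable_fun [set: borel_rV R d * borel_rV R d]
  (fun xy => (enorm (xy.1 - xy.2 : 'rV[R]_d))%:E).
Proof.
apply/measurable_EFinP.
apply: (@measurableT_comp _ _ _ _ _ _ (@Num.sqrt R)).
  by apply: continuous_measurable_fun; exact: sqrt_continuous.
apply: measurable_sum => i.
have mi : measurable_fun [set: borel_rV R d * borel_rV R d]
    (fun xy => (xy.1 - xy.2 : 'rV[R]_d) ord0 i).
  under eq_fun do rewrite !mxE.
  apply: measurable_funB.
    exact: measurableT_comp (measurable_coord i) measurable_fst.
  exact: measurableT_comp (measurable_coord i) measurable_snd.
exact: measurable_funM.
Qed.

End borel.

(** * Lower and upper bounds on transport costs *)

(** The halfspace carrying [P] is [{x | <u, x - z> <= -c}], at distance [c] from [halfspace u z].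
    Under any coupling almost every pair has its second point there, so a pair whose first point
    lies in [halfspace u z] costs at least [c]. *)
Lemma halfspace_mass_le_wasserstein {R : realType} {d : nat} (P P' : law R d)
    (u z : 'rV[R]_d) (c : R) : enorm u = 1 -> 0 <= c ->
  P (halfspace (- u) (z - c *: u)) = 1%E ->
  (c%:E * P' (halfspace u z) <= wasserstein P' P)%E.
Proof.
move=> u1 c0 PS; apply: le_ereal_inf_tmp => _ [Pi PiC <-].
set h := halfspace u z; set S := halfspace _ _ in PS.
have mh : measurable h := measurable_halfspace u z.
have mS : measurable S := measurable_halfspace _ _.
have mfh : measurable (fst @^-1` h : set (borel_rV R d * borel_rV R d)).
  by rewrite -[X in measurable X]setTI; exact: measurable_fst.
have msS : measurable (snd @^-1` S : set (borel_rV R d * borel_rV R d)).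
  by rewrite -[X in measurable X]setTI; exact: measurable_snd.
have PiSC : Pi (~` (snd @^-1` S)) = 0%E.
  by rewrite probability_setC// (PiC S mS).2 PS subee.
rewrite -(PiC h mh).1.
have -> : Pi (fst @^-1` h) = Pi (fst @^-1` h `&` snd @^-1` S).
  rewrite -[in LHS](setIT (fst @^-1` h)) -(setUv (snd @^-1` S)) setIUr.
  rewrite measureU0//; [exact: measurableI|exact/measurableI/measurableC|].
  apply: subset_measure0 PiSC => //.
  - exact/measurableI/measurableC.
  - exact: measurableC.
rewrite -integral_cst; last exact: measurableI.
apply: (@le_trans _ _ (\int[Pi]_(xy in fst @^-1` h `&` snd @^-1` S)
   (enorm (xy.1 - xy.2 : 'rV[R]_d))%:E)%E); last first.
  apply: ge0_subset_integral => //; first exact: measurableI.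
    exact: measurable_edist.
  by move=> xy _; rewrite lee_fin enorm_ge0.
apply: ge0_le_integral => //.
- exact: measurableI.
- by apply: measurable_funTS; exact: measurable_edist.
move=> [a b] [/=]; rewrite /h /S /halfspace/= => ha hb; rewrite lee_fin.
(* Since [u] is a unit vector, [|a - b| >= <u, a - b>], and the two halfspace conditions make this
   at least [c]. *)
have := cauchy_schwarz u (a - b); rewrite u1 mul1r; apply: le_trans.
by move: ha hb; rewrite innerNl !innerBr innerZr -sqr_enorm u1; lra.
Qed.

Lemma probability_of_measure (disp : measure_display) (T : measurableType disp)
    (R : realType) (mu : {measure set T -> \bar R}) :
  mu setT = 1%E -> exists P : probability T R, forall A, P A = mu A.
Proof.
case: mu => f c mu1.
pose P : probability T R := HB.pack f c
  (Measure_isProbability.Build _ _ _ (Measure.Pack c) mu1).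
by exists P.
Qed.

(** The coupling leaves mass [1/n - p i] at [(x i, x i)], at no cost, and puts mass [p i] at
    [(y i, x i)]; [P'] is its first marginal. *)
Lemma partial_transport {R : realType} {d n : nat} (n_gt0 : (0 < n)%N)
    (x y : 'I_n -> 'rV[R]_d) (p : 'I_n -> R) :
  (forall i, 0 <= p i <= n%:R^-1) ->
  exists2 P' : law R d,
    (wasserstein P' (empirical n_gt0 x) <=
      (\sum_(i < n) p i * enorm (y i - x i))%:E)%E &
    forall A : set (borel_rV R d), (forall i, A (y i)) ->
      ((\sum_(i < n) p i)%:E <= P' A)%E.
Proof.
(* [msum] takes a family indexed by [nat]; with index type ['I_n.+1], [inord] turns these indices
   back into ordinals. *)
case: n n_gt0 x y p => // n n_gt0 x y p p01.
have p0 i : 0 <= p i by case/andP: (p01 i).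
have q0 i : 0 <= n.+1%:R^-1 - p i by rewrite subr_ge0; case/andP: (p01 i).
pose T := (borel_rV R d * borel_rV R d)%type.
pose m_ (k : nat) : {measure set T -> \bar R} := measure_add
  (mscale (NngNum (q0 (inord k))) \d_((x (inord k), x (inord k)) : T))
  (mscale (NngNum (p0 (inord k))) \d_((y (inord k), x (inord k)) : T)).
have m_E (A : set T) : msum m_ n.+1 A =
    (\sum_(i < n.+1) ((n.+1%:R^-1 - p i)%:E * \d_((x i, x i) : T) A +
                      (p i)%:E * \d_((y i, x i) : T) A))%E.
  apply: eq_bigr => i _; rewrite /m_ inord_val.
  exact: measure_addE.
have m_snd A : msum m_ n.+1 (snd @^-1` A) = empirical n_gt0 x A.
  rewrite m_E /empirical ge0_sume_distrr//; apply: eq_bigr => i _.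
  have -> : \d_((x i, x i) : T) (snd @^-1` A) = \d_(x i : borel_rV R d) A :> \bar R.
    by [].
  have -> : \d_((y i, x i) : T) (snd @^-1` A) = \d_(x i : borel_rV R d) A :> \bar R.
    by [].
  by rewrite -ge0_muleDl ?lee_fin// -EFinD subrK.
have [|Pi PiE] := @probability_of_measure _ T R (msum m_ n.+1).
  rewrite -(preimage_setT snd); apply: etrans (m_snd _) _.
  exact: (probability_setT (empirical n_gt0 x)).
pose fst' : {mfun T >-> borel_rV R d} := HB.pack (@fst _ _ : T -> borel_rV R d)
  (isMeasurableFun.Build _ _ T (borel_rV R d) _ measurable_fst).
exists (distribution Pi fst').
  apply: (@le_trans _ _ (\int[Pi]_xy (enorm (xy.1 - xy.2 : 'rV[R]_d))%:E)%E).
    apply: ereal_inf_lbound; exists Pi => // A mA; split => //.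
    exact: etrans (PiE _) (m_snd A).
  (* Passing from [Pi] back to the explicit sum lets the integral split into integrals against Dirac
     masses. *)
  rewrite (eq_measure_integral (msum m_ n.+1)); last by move=> A _ _; exact: PiE.
  have f0 (xy : T) : [set: T] xy -> (0 <= (enorm (xy.1 - xy.2 : 'rV[R]_d))%:E)%E.
    by rewrite lee_fin enorm_ge0.
  have mf := @measurable_edist R d.
  rewrite ge0_integral_measure_sum// -sumEFin; apply: lee_sum => i _.
  rewrite ge0_integral_measure_add// !ge0_integral_mscale// !integral_dirac//.
  by rewrite !diracT !mul1e /= inord_val subrr enorm0 mule0 add0e.
move=> A Ay; rewrite [leRHS](etrans (PiE _) (m_E _)) -sumEFin; apply: lee_sum => i _.
rewrite [X in (_ + _ * X)%E](_ : _ = 1%E).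
  by rewrite mule1 leeDr// mule_ge0// lee_fin.
by rewrite diracE mem_set//; exact: Ay.
Qed.

(** * Bounds on the depth far from the hull and near it *)

Section depth_bounds.
Context {R : realType} {d n : nat} (n_gt0 : (0 < n)%N).
Context (x : 'I_n -> 'rV[R]_d) (delta : R).
Hypothesis delta_gt0 : 0 < delta.
Implicit Types (u y z : 'rV[R]_d) (c : R).

Lemma empirical_full (A : set (borel_rV R d)) :
  (forall i, A (x i)) -> empirical n_gt0 x A = 1%E.
Proof.
move=> Ax; rewrite -(probability_setT (empirical n_gt0 x)).
by congr (_ * _)%E; apply: eq_bigr => i _; rewrite diracT diracE mem_set.
Qed.

Lemma enorm_hull_le y : convex_hull x y -> enorm y <= \sum_(i < n) enorm (x i).
Proof.
move=> [w [w0 w1 ->]]; apply: le_trans (enorm_sum _ _) _.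
apply: ler_sum => i _; rewrite enormZ ger0_norm// ler_piMl ?enorm_ge0//.
by rewrite -w1 (bigD1 i)//= lerDl sumr_ge0.
Qed.

Lemma dist_hull_enorm z :
  `|dist_set z (convex_hull x) - enorm z| <= \sum_(i < n) enorm (x i).
Proof.
have [y Hy ->] := dist_set_attained x z n_gt0.
have yK := enorm_hull_le _ Hy.
have := ler_enormD (z - y) y; rewrite subrK => zle.
have := ler_enormD z (- y); rewrite enormN => zge.
by rewrite ler_norml; lra.
Qed.

Lemma vertex_inner_le u z y : enorm u = 1 -> convex_hull x y ->
  exists i, inner u (z - x i) <= enorm (z - y).
Proof.
move=> u1 [w [w0 w1 yE]]; apply: contrapT => /forallNP far.
have gap i : 0 < inner u (z - x i) - enorm (z - y).
  by rewrite subr_gt0 ltNge; apply/negP/far.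
have w_gap0 i : 0 <= w i * (inner u (z - x i) - enorm (z - y)).
  by rewrite mulr_ge0// ltW.
have sum0 : \sum_(i < n) w i * (inner u (z - x i) - enorm (z - y)) = 0.
  apply/le_anti; rewrite sumr_ge0 ?andbT//.
  have -> : \sum_(i < n) w i * (inner u (z - x i) - enorm (z - y)) =
      inner u (z - y) - enorm (z - y).
    under eq_bigr do rewrite mulrBr innerBr mulrBr.
    rewrite !sumrB -!mulr_suml w1 !mul1r yE innerBr inner_sumr.
    by under [in RHS]eq_bigr do rewrite innerZr.
  by rewrite subr_le0 (le_trans (cauchy_schwarz _ _))// u1 mul1r.
(* Nonnegative terms with zero sum all vanish; the gaps being positive, every weight is zero,
   against their sum being 1. *)
have : \sum_(i < n) w i = 0.
  apply: big1 => i _; apply/eqP.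
  suff : w i * (inner u (z - x i) - enorm (z - y)) == 0.
    by rewrite mulf_eq0 (gt_eqF (gap i)) orbF.
  by apply/eqP; apply: (psumr_eq0P (fun j _ => w_gap0 j) sum0).
by rewrite w1 => /eqP; rewrite oner_eq0.
Qed.

(** Reduces a lower bound on the depth to choosing, for each direction, how much of each atom to
    move under the budget [delta]. *)
Lemma depth_ge z c :
  (forall u, enorm u = 1 -> exists p : 'I_n -> R,
    [/\ forall i, 0 <= p i <= n%:R^-1,
        \sum_(i < n) p i * Num.max 0 (inner u (z - x i)) <= delta &
        c <= \sum_(i < n) p i]) ->
  (c%:E <= robust_depth delta z (empirical n_gt0 x))%E.
Proof.
move=> hp; apply: le_ereal_inf_tmp => _ [u u1 <-].
have [p [p01 cost cp]] := hp u u1.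
(* The projection of [x i] onto the halfspace, equal to [x i] if it already lies inside. *)
pose y i := x i + Num.max 0 (inner u (z - x i)) *: u.
have [P' WP' massP'] := partial_transport n_gt0 x y p p01.
apply: le_ereal_sup_tmp; exists (P' (halfspace u z)).
  exists P' => //=; apply: le_trans WP' _; rewrite lee_fin.
  apply: le_trans cost; apply: ler_sum => i _.
  by rewrite /y addrC addKr enormZ u1 mulr1 ger0_norm// le_max lexx.
apply: (@le_trans _ _ (\sum_(i < n) p i)%:E); first by rewrite lee_fin.
apply: massP' => i; rewrite /halfspace/= /y.
rewrite innerBr innerDr innerZr -sqr_enorm u1 expr1n mulr1.
have : inner u (z - x i) <= Num.max 0 (inner u (z - x i)).
  by rewrite le_max lexx orbT.
by rewrite {1}innerBr; lra.
Qed.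

Lemma depth_le z : 0 < dist_set z (convex_hull x) ->
  (robust_depth delta z (empirical n_gt0 x) <=
    (delta / dist_set z (convex_hull x))%:E)%E.
Proof.
have [y Hy Dzy] := dist_set_attained x z n_gt0.
have obt := projection_obtuse _ _ _ Hy Dzy.
rewrite Dzy => D0; set D := enorm (z - y) in D0 *.
pose u := D^-1 *: (z - y).
have u1 : enorm u = 1.
  by rewrite enormZ ger0_norm ?invr_ge0 ?enorm_ge0// mulVf// gt_eqF.
have PS : empirical n_gt0 x (halfspace (- u) (z - D *: u)) = 1%E.
  apply: empirical_full => i.
  rewrite /halfspace/= innerNl -innerNr opprB innerBr innerBr innerZr.
  rewrite -sqr_enorm u1 expr1n mulr1.
  (* The obtuse angle at [y] puts every atom beyond the hyperplane through [y] orthogonal to [u],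
     hence at distance at least [D] from the halfspace. *)
  have : D ^+ 2 <= inner (z - y) (z - x i).
    have -> : z - x i = (z - y) - (x i - y) by rewrite opprB addrA subrK.
    by rewrite innerBr -sqr_enorm -/D lerBrDl gerDr obt.
  by rewrite expr2 -ler_pdivlMl// -innerZl -/u innerBr; lra.
apply: le_trans; first by apply: ereal_inf_lbound; exists u.
apply: ge_ereal_sup => _ [P' WP' <-].
have := halfspace_mass_le_wasserstein _ P' u z D u1 (ltW D0) PS.
by move=> /le_trans/(_ WP') h; rewrite EFinM muleC lee_pdivlMl.
Qed.

Lemma depth_far z : delta * n%:R <= dist_set z (convex_hull x) ->
  robust_depth delta z (empirical n_gt0 x) =
    (delta / dist_set z (convex_hull x))%:E
  /\ delta / dist_set z (convex_hull x) <= n%:R^-1.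
Proof.
move=> Dge; have n0 : 0 < n%:R :> R by rewrite ltr0n.
have D0 : 0 < dist_set z (convex_hull x).
  by apply: lt_le_trans Dge; rewrite mulr_gt0.
have Dn : delta / dist_set z (convex_hull x) <= n%:R^-1.
  by rewrite ler_pdivrMr// mulrC ler_pdivlMr.
split => //; apply/le_anti/andP; split; first exact: depth_le.
apply: depth_ge => u u1.
have [y Hy Dzy] := dist_set_attained x z n_gt0.
have [i0 i0D] := vertex_inner_le u z y u1 Hy; rewrite -Dzy in i0D.
(* One atom within reach [D] absorbs the whole budget; [Dn] ensures that it has enough mass. *)
exists (fun i => if i == i0 then delta / dist_set z (convex_hull x) else 0).
split => [i||].
- case: eqP => _; first by rewrite Dn divr_ge0// ltW.
  by rewrite lexx invr_ge0 ltW.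
- rewrite (bigD1 i0)//= eqxx big1 ?addr0 => [|i /negbTE ->]; last by rewrite mul0r.
  rewrite mulrAC ler_pdivrMr// ler_pM2l//.
  by rewrite ge_max i0D ltW.
- by rewrite (bigD1 i0)//= eqxx big1 ?addr0// => i /negbTE ->.
Qed.

(** The depth is an infimum over [u], so strictness requires a bound independent of [u]: here
    [1/n + (n-1) q]. *)
Lemma depth_near z alpha : dist_set z (convex_hull x) < delta * n%:R ->
  alpha <= n%:R^-1 -> alpha < 1 ->
  (alpha%:E < robust_depth delta z (empirical n_gt0 x))%E.
Proof.
move=> Dlt an a1; have n0 : 0 < n%:R :> R by rewrite ltr0n.
pose M := \sum_(i < n) enorm (z - x i).
have M0 : 0 <= M by apply: sumr_ge0 => i _; exact: enorm_ge0.
set D := dist_set z (convex_hull x) in Dlt *.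
have e0 : 0 < delta - n%:R^-1 * D by rewrite subr_gt0 ltr_pdivrMl// mulrC.
(* A full atom costs at most [D/n]. The rest of the budget is shared among the other atoms, each at
   distance at most [M] in every direction; [M + 1] avoids a zero denominator. *)
pose q := Num.min n%:R^-1 ((delta - n%:R^-1 * D) / (n%:R * (M + 1))).
have nM0 : 0 < n%:R * (M + 1) by rewrite mulr_gt0// ltr_wpDl.
have q0 : 0 < q by rewrite lt_min invr_gt0 n0 divr_gt0.
have qM : n%:R * (q * M) <= delta - n%:R^-1 * D.
  have : q * (n%:R * (M + 1)) <= delta - n%:R^-1 * D.
    by rewrite -ler_pdivlMr// ge_min lexx orbT.
  apply: le_trans; rewrite mulrCA ler_pM2l// ler_pM2l//; lra.
apply: (@lt_le_trans _ _ (n%:R^-1 + q *+ n.-1)%:E).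
  (* For [n = 1] there is no other atom and the bound is 1, so [alpha < 1] gives strictness;
     otherwise the positive surplus [(n-1) q] does. *)
  rewrite lte_fin; case: (posnP n.-1) => [n1|n1].
    rewrite n1 mulr0n addr0.
    have -> : n%:R = 1 :> R by rewrite -(prednK n_gt0) n1.
    by rewrite invr1.
  by rewrite (le_lt_trans an)// ltrDl -mulr_natr mulr_gt0// ltr0n.
apply: depth_ge => u u1.
have [y Hy Dzy] := dist_set_attained x z n_gt0.
have [i0 i0D] := vertex_inner_le u z y u1 Hy; rewrite -Dzy -/D in i0D.
exists (fun i => if i == i0 then n%:R^-1 else q); split => [i||].
- case: eqP => _; first by rewrite lexx invr_ge0 ltW.
  by rewrite ltW//= ge_min lexx.
- rewrite (bigD1 i0)//= eqxx.
  have h1 : n%:R^-1 * Num.max 0 (inner u (z - x i0)) <= n%:R^-1 * D.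
    by rewrite ler_pM2l ?invr_gt0// ge_max i0D andbT /D Dzy enorm_ge0.
  suff : \sum_(i < n | i != i0) (if i == i0 then n%:R^-1 else q) *
      Num.max 0 (inner u (z - x i)) <= n%:R * (q * M) by lra.
  apply: (@le_trans _ _ (\sum_(i < n | i != i0) q * M)).
    apply: ler_sum => i /negbTE ->; rewrite ler_pM2l// ge_max M0/=.
    rewrite (le_trans (cauchy_schwarz _ _))// u1 mul1r /M (bigD1 i)//= lerDl.
    by apply: sumr_ge0 => j _; exact: enorm_ge0.
  rewrite [leRHS](_ : _ = \sum_(i < n) q * M); last first.
    by rewrite sumr_const card_ord mulr_natl.
  by rewrite [leRHS](bigD1 i0)//= lerDr mulr_ge0// ltW.
- rewrite (bigD1 i0)//= eqxx lerD2l.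
  under eq_bigr => i /negbTE -> do [].
  by rewrite sumr_const cardC1 card_ord.
Qed.

End depth_bounds.

(** * Exact depth, level sets and decay at infinity *)

(** Given [alpha <= 1/n], the condition [alpha < 1] excludes only [n = 1], [alpha = 1]: there every
    [z] within [delta] of the single point has depth 1, so the level set is a ball and not a
    sphere. *)
Theorem proposition9 (R : realType) (d n : nat) (d_gt0 : (0 < d)%N)
    (n_gt0 : (0 < n)%N) (x : 'I_n -> 'rV[R]_d)
    (delta : R) (delta_gt0 : 0 < delta) :
  let Pn : law R d := empirical n_gt0 x in
  let H := convex_hull x in
  [/\ forall z : 'rV[R]_d, delta * n%:R <= dist_set z H ->
        robust_depth delta z Pn = (delta / dist_set z H)%:E
        /\ delta / dist_set z H <= n%:R^-1,
      forall alpha : R, 0 < alpha -> alpha <= n%:R^-1 -> alpha < 1 ->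
        [set z : 'rV[R]_d | robust_depth delta z Pn = alpha%:E]
        = [set z : 'rV[R]_d | dist_set z H = delta / alpha]
    & ((enorm z)%:E * robust_depth delta z Pn)%E @[z --> @enorm_infty R d]
        --> delta%:E ].
Proof.
move=> Pn H; have n0 : 0 < n%:R :> R by rewrite ltr0n.
have far z : delta * n%:R <= dist_set z H ->
    robust_depth delta z Pn = (delta / dist_set z H)%:E
    /\ delta / dist_set z H <= n%:R^-1 by exact: depth_far.
split => // [alpha a0 an a1|].
  apply/seteqP; split => z /= hz.
    have [Dge|Dlt] := leP (delta * n%:R) (dist_set z H).
      have [] := far z Dge; rewrite hz => -[->] _.
      by rewrite invfM invrK mulrA divff ?gt_eqF// mul1r.
    by have := depth_near n_gt0 x delta z alpha Dlt an a1; rewrite -/Pn hz ltxx.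
  have [] := far z; first by rewrite hz ler_pM2l// -[n%:R]invrK lef_pV2 ?posrE ?invr_gt0.
  by rewrite hz => -> _; rewrite invfM invrK mulrA divff ?gt_eqF// mul1r.
pose K := \sum_(i < n) enorm (x i).
have K0 : 0 <= K by apply: sumr_ge0 => i _; exact: enorm_ge0.
move=> A Adelta.
have /nbhs_ballP[e /= e0 eA] : nbhs delta (fun r => A r%:E) by exact: Adelta.
(* As [D >= |z| - K], the first two terms bring [z] into the far regime, and the third gives
   [D > delta K / e], so that the error [delta |D - |z|| / D] is below [e]. *)
exists (delta * n%:R + K + delta * K / e) => // z /= Mz.
have := dist_hull_enorm n_gt0 x z; rewrite -/K -/H ler_norml => /andP[lo hi].
have deK : 0 <= delta * K / e by rewrite divr_ge0 ?mulr_ge0// ltW.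
have dn0 : 0 < delta * n%:R by rewrite mulr_gt0.
have [|depthE _] := far z; first by lra.
set D := dist_set z H in lo hi depthE.
have D0 : 0 < D by lra.
have De : delta * K < e * D by rewrite [ltRHS]mulrC -ltr_pdivrMr//; lra.
rewrite depthE -EFinM; apply: eA; rewrite /ball/=.
have -> : delta - enorm z * (delta / D) = delta * (D - enorm z) / D.
  by field; rewrite gt_eqF.
rewrite normrM normfV (gtr0_norm D0) ltr_pdivrMr// normrM (gtr0_norm delta_gt0).
by apply: le_lt_trans De; rewrite ler_pM2l// ler_norml lo.
Qed.
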